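(* Let $r\le n$, $q\le n^2$, let $\mathcal{A}:\mathbb{R}^{n\times n}\to\mathbb{R}^q$ be a linear map, $\bm{b}\in\mathbb{R}^q$, $\lambda\ge0$, and let $\Psi,\Phi:\mathbb{R}^{n\times r}\to\mathbb{R}\cup\{+\infty\}$ be proper closed functions. Suppose that $\mathcal{A}\mathcal{A}^*=\mathcal{I}_q$. If $\alpha$ and $\beta$ are chosen such that $\alpha\mathcal{I}+\beta\mathcal{A}^*\mathcal{A}\succ0$ and $\frac1\alpha+\frac1\beta=1$, then the problem $\min_{X,Y,Z}\{\Theta_{\alpha,\beta,\lambda}(X,Y,Z)\}$ is equivalent to the problem $\min_{X,Y}\{\mathcal{F}_\lambda(X,Y)\}$.
   Context: For $X,Y\in\mathbb{R}^{n\times r}$ and $Z\in\mathbb{R}^{n\times n}$, $$\mathcal{F}_\lambda(X,Y):=\Psi(X)+\Phi(Y)+\tfrac12\|\mathcal{A}(XY^\top)-\bm{b}\|^2+\tfrac{\lambda}{2}\|X-Y\|_F^2,$$ $$\Theta_{\alpha,\beta,\lambda}(X,Y,Z):=\Psi(X)+\Phi(Y)+\tfrac{\alpha}{2}\|XY^\top-Z\|_F^2+\tfrac{\beta}{2}\|\mathcal{A}(Z)-\bm{b}\|^2+\tfrac{\lambda}{2}\|X-Y\|_F^2 .$$ $\|\cdot\|$ is the Euclidean norm, $\|\cdot\|_F$ the Frobenius norm; $\mathcal{A}^*$ is the adjoint of $\mathcal{A}$; $\mathcal{I}_q$ and $\mathcal{I}$ are the identity maps on $\mathbb{R}^q$ and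 $\mathbb{R}^{n\times n}$; $\succ0$ means positive definite (as a self-adjoint operator on $\mathbb{R}^{n\times n}$). A function is closed if it is lower semicontinuous. *)

(* Defs.v *)
From mathcomp Require Import all_boot all_order all_algebra.
From mathcomp Require Import all_classical all_reals all_analysis.

Set Implicit Arguments.
Unset Strict Implicit.
Unset Printing Implicit Defensive.

Import Order.TTheory GRing.Theory Num.Theory.
Import numFieldNormedType.Exports.

Local Open Scope classical_set_scope.
Local Open Scope ring_scope.

Section InnerProduct.
Context {R : realType}.

(* On column vectors these are the Euclidean inner product and norm.  The
   library norm `|X| of a matrix is the max norm, hence is not used. *)
Definition frob_dot m n (X Y : 'M[R]_(m, n)) : R := \tr (X^T *m Y).
Definition frob_norm m n (X : 'M[R]_(m, n)) : R := Num.sqrt (frob_dot X X).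

Lemma frob_dotE m n (X Y : 'M[R]_(m, n)) :
  frob_dot X Y = \sum_i \sum_j X i j * Y i j.
Proof.
rewrite /frob_dot /mxtrace exchange_big; apply: eq_bigr => j _.
by rewrite mxE; apply: eq_bigr => i _; rewrite mxE.
Qed.

(* Coordinates in the orthonormal basis of elementary matrices; see
   [adjmapP] and [adjmap_unique] for the characteristic property. *)
Definition adjmap m n q (A : {linear 'M[R]_(m, n) -> 'cV[R]_q}) (y : 'cV[R]_q) :
    'M[R]_(m, n) :=
  \matrix_(i, j) frob_dot (A (delta_mx i j)) y.

Lemma adjmapP m n q (A : {linear 'M[R]_(m, n) -> 'cV[R]_q}) Z y :
  frob_dot (A Z) y = frob_dot Z (adjmap A y).
Proof.
rewrite {1}[Z]matrix_sum_delta linear_sum /= [RHS]frob_dotE.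
rewrite /frob_dot linear_sum mulmx_suml raddf_sum; apply: eq_bigr => i _ /=.
rewrite linear_sum linear_sum mulmx_suml raddf_sum; apply: eq_bigr => j _ /=.
by rewrite 2!linearZ -scalemxAl mxtraceZ mxE.
Qed.

Lemma adjmap_unique m n q (A : {linear 'M[R]_(m, n) -> 'cV[R]_q})
    (B : 'cV[R]_q -> 'M[R]_(m, n)) :
  (forall Z y, frob_dot (A Z) y = frob_dot Z (B y)) -> B =1 adjmap A.
Proof.
move=> AB y; apply/matrixP => i j; rewrite mxE AB frob_dotE.
rewrite (bigD1 i) //= (bigD1 j) //= !mxE !eqxx mul1r.
rewrite big1 => [|k kj]; last by rewrite mxE (negPf kj) andbF mul0r.
rewrite big1 ?addr0 // => k ki; rewrite big1 // => l _.
by rewrite mxE (negPf ki) mul0r.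
Qed.

Definition selfadjoint m n (T : 'M[R]_(m, n) -> 'M[R]_(m, n)) : Prop :=
  forall Z W, frob_dot (T Z) W = frob_dot Z (T W).

Definition posdef m n (T : 'M[R]_(m, n) -> 'M[R]_(m, n)) : Prop :=
  selfadjoint T /\ forall Z, Z != 0 -> 0 < frob_dot (T Z) Z.

End InnerProduct.

Definition proper_function {R : realType} {U : Type} (f : U -> \bar R) : Prop :=
  (forall u, f u != -oo%E) /\ exists u, (f u < +oo)%E.

Section Problems.
Context {R : realType} (n r q : nat).
Variables (Psi Phi : 'M[R]_(n, r) -> \bar R).
Variables (A : {linear 'M[R]_n -> 'cV[R]_q}) (b : 'cV[R]_q).

Definition F_obj (lambda : R) (XY : 'M[R]_(n, r) * 'M[R]_(n, r)) : \bar R :=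
  let: (X, Y) := XY in
  (Psi X + Phi Y
   + (2^-1 * frob_norm (A (X *m Y^T) - b) ^+ 2
      + lambda / 2 * frob_norm (X - Y) ^+ 2)%:E)%E.

Definition Theta_obj (alpha beta lambda : R)
    (XYZ : ('M[R]_(n, r) * 'M[R]_(n, r)) * 'M[R]_n) : \bar R :=
  let: (X, Y, Z) := XYZ in
  (Psi X + Phi Y
   + (alpha / 2 * frob_norm (X *m Y^T - Z) ^+ 2
      + beta / 2 * frob_norm (A Z - b) ^+ 2
      + lambda / 2 * frob_norm (X - Y) ^+ 2)%:E)%E.

End Problems.

Definition optimal_value {R : realType} {U : Type} (f : U -> \bar R) : \bar R :=
  ereal_inf (range f).

Definition minimizer {R : realType} {U : Type} (f : U -> \bar R) (u : U) : Prop :=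
  forall v, (f u <= f v)%E.

(* min_(u, w) g is equivalent to min_u f, where w is an auxiliary variable:
   eliminating w by (attained) minimization turns g into f, the optimal values
   agree, and solutions of either problem yield solutions of the other one. *)
Definition equivalent_problems {R : realType} {U W : Type}
    (g : U * W -> \bar R) (f : U -> \bar R) : Prop :=
  [/\ forall u, exists2 w, minimizer (fun w' => g (u, w')) w & g (u, w) = f u,
      optimal_value g = optimal_value f,
      forall u, minimizer f u <-> exists w, minimizer g (u, w)
    & forall u w, minimizer g (u, w) <->
        minimizer f u /\ minimizer (fun w' => g (u, w')) w].

(* Main.v *)
Require Import Defs.
From mathcomp Require Import all_boot all_order all_algebra.
From mathcomp Require Import all_classical all_reals all_analysis.
From mathcomp Require Import ring.

Set Implicit Arguments.
Unset Strict Implicit.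
Unset Printing Implicit Defensive.

Import Order.TTheory GRing.Theory Num.Theory.
Import numFieldNormedType.Exports.

Local Open Scope ring_scope.

(** For fixed X and Y, put M = X Y^T, c = b - A M and W = M + alpha^-1 A^* c.
    Since A A^* = I and 1/alpha + 1/beta = 1, completing the square at W gives
      alpha/2 |M - Z|^2 + beta/2 |A Z - b|^2
        = 1/2 |c|^2 + 1/2 <(alpha I + beta A^* A)(Z - W), Z - W>,
    so that W minimizes Theta over Z, with minimal value F. *)

Section FrobDot.
Context {R : realType}.

Lemma frob_dotC m n (X Y : 'M[R]_(m, n)) : frob_dot X Y = frob_dot Y X.
Proof. by rewrite /frob_dot -mxtrace_tr trmx_mul trmxK. Qed.

Lemma frob_dotDr m n (X Y Z : 'M[R]_(m, n)) :
  frob_dot X (Y + Z) = frob_dot X Y + frob_dot X Z.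
Proof. by rewrite /frob_dot mulmxDr mxtraceD. Qed.

Lemma frob_dotZr m n (a : R) (X Y : 'M[R]_(m, n)) :
  frob_dot X (a *: Y) = a * frob_dot X Y.
Proof. by rewrite /frob_dot -scalemxAr mxtraceZ. Qed.

Lemma frob_dotDl m n (X Y Z : 'M[R]_(m, n)) :
  frob_dot (X + Y) Z = frob_dot X Z + frob_dot Y Z.
Proof. by rewrite !(frob_dotC _ Z) frob_dotDr. Qed.

Lemma frob_dotZl m n (a : R) (X Y : 'M[R]_(m, n)) :
  frob_dot (a *: X) Y = a * frob_dot X Y.
Proof. by rewrite !(frob_dotC _ Y) frob_dotZr. Qed.

Lemma frob_dot_ge0 m n (X : 'M[R]_(m, n)) : 0 <= frob_dot X X.
Proof.
by rewrite frob_dotE; do 2!apply: sumr_ge0 => ? _; rewrite -expr2 sqr_ge0.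
Qed.

Lemma frob_norm_sq m n (X : 'M[R]_(m, n)) : frob_norm X ^+ 2 = frob_dot X X.
Proof. by rewrite sqr_sqrtr ?frob_dot_ge0. Qed.

Lemma posdef_ge0 m n (T : 'M[R]_(m, n) -> 'M[R]_(m, n)) Z :
  posdef T -> 0 <= frob_dot (T Z) Z.
Proof.
move=> [_ T_gt0]; have [->|/T_gt0/ltW //] := eqVneq Z 0.
by rewrite /frob_dot mulmx0 mxtrace0.
Qed.

(** With c = b - A M, the terms linear in D cancel: the first square contributes <c, A D>, the
    second beta (1/alpha - 1) <c, A D> = - <c, A D>. The constant terms add up to (1/alpha +
    1/beta)/2 |c|^2, because |A^* c| = |c|. *)
Lemma penalty_complete_square m n q (A : {linear 'M[R]_(m, n) -> 'cV[R]_q})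
    (b : 'cV[R]_q) (alpha beta : R) (M D : 'M[R]_(m, n)) :
  (forall y, A (adjmap A y) = y) ->
  alpha != 0 -> beta != 0 -> 1 / alpha + 1 / beta = 1 ->
  let Z := M + alpha^-1 *: adjmap A (b - A M) + D in
  alpha / 2 * frob_norm (M - Z) ^+ 2 + beta / 2 * frob_norm (A Z - b) ^+ 2
  = 2^-1 * frob_norm (A M - b) ^+ 2
    + 2^-1 * frob_dot (alpha *: D + beta *: adjmap A (A D)) D.
Proof.
move=> AAK alpha0 beta0 albe /=.
have [c ->] : exists c, b = A M + c by exists (b - A M); rewrite subrKC.
have -> : A M + c - A M = c by rewrite addrAC subrr add0r.
have -> : A M - (A M + c) = -1 *: c by rewrite scaleN1r opprD addrA subrr add0r.
have -> : M - (M + alpha^-1 *: adjmap A c + D)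
          = -1 *: (alpha^-1 *: adjmap A c + D).
  by rewrite scaleN1r -addrA opprD addrA subrr add0r.
have -> : A (M + alpha^-1 *: adjmap A c + D) - (A M + c)
          = (alpha^-1 - 1) *: c + A D.
  by rewrite !linearD linearZ /= AAK scalerBl scale1r -!addrA addrC
    -!addrA (addrC _ (A M)) addKr (addrC (A D)).
rewrite !frob_norm_sq.
(* Moving every adjoint across leaves only <c, c>, <c, A D>, <A D, A D> and <D, D>. *)
rewrite !(frob_dotDl, frob_dotDr, frob_dotZl, frob_dotZr).
rewrite !(frob_dotC (adjmap A _)) -!adjmapP !AAK !(frob_dotC (A D) c).
(* Eliminating alpha turns the goal into a rational identity in beta, with denominators beta and
   beta - 1. *)
have betaB : beta - 1 = beta / alpha.
  by rewrite -[X in X - 1]mulr1 -{1}albe mulrDr !div1r mulfV// addrK.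
have betaB0 : beta - 1 != 0 by rewrite betaB mulf_neq0 ?invr_eq0.
have -> : alpha = beta / (beta - 1).
  by rewrite betaB invf_div mulrC divfK.
by field; rewrite beta0 betaB0.
Qed.

End FrobDot.

(** The hypotheses make f the partial minimum of g, attained along [s]; the rest is order reasoning,
    valid for infinite values too. *)
Lemma equivalent_problems_partial_min {R : realType} {U W : Type}
    (g : U * W -> \bar R) (f : U -> \bar R) (s : U -> W) :
  (forall u, g (u, s u) = f u) -> (forall u w, (f u <= g (u, w))%E) ->
  equivalent_problems g f.
Proof.
move=> gs fg.
have joint u w : minimizer g (u, w) <->
    minimizer f u /\ minimizer (fun w' => g (u, w')) w.
  (* Forward: compare with (v, s v). Backward: g (u, w) <= g (u, s u) = f u <= f v <= g (v, w'). *)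
  split=> [gmin|[fmin gmin] [v w']].
    by split=> [v|w'] //; rewrite (le_trans (fg u w))// -gs.
  by rewrite (le_trans (gmin (s u)))// gs (le_trans (fmin v)).
have smin u : minimizer (fun w => g (u, w)) (s u) by move=> w; rewrite gs.
split=> // [u||u]; first by exists (s u).
- apply/eqP; rewrite eq_le; apply/andP; split.
    apply: le_ereal_inf_tmp => _ [u _ <-]; rewrite -gs.
    by apply: ereal_inf_lbound; exists (u, s u).
  apply: le_ereal_inf_tmp => _ [[u w] _ <-]; rewrite (le_trans _ (fg u w))//.
  by apply: ereal_inf_lbound; exists u.
- by split=> [fmin|[w /joint[]//]]; exists (s u); apply/joint.
Qed.

(** Nonzero alpha and beta are explicit because 0^-1 = 0 here: alpha = 0, beta = 1 would satisfy 1 /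
    alpha + 1 / beta = 1. *)
Theorem theorem3p2 (R : realType) (n r q : nat)
    (A : {linear 'M[R]_n -> 'cV[R]_q}) (b : 'cV[R]_q)
    (alpha beta lambda : R) (Psi Phi : 'M[R]_(n, r) -> \bar R) :
  (r <= n)%N ->
  (q <= n ^ 2)%N ->
  0 <= lambda ->
  proper_function Psi -> lower_semicontinuous Psi ->
  proper_function Phi -> lower_semicontinuous Phi ->
  (forall y : 'cV[R]_q, A (adjmap A y) = y) ->
  alpha != 0 -> beta != 0 ->
  posdef (fun Z : 'M[R]_n => alpha *: Z + beta *: adjmap A (A Z)) ->
  1 / alpha + 1 / beta = 1 ->
  equivalent_problems (Theta_obj Psi Phi A b alpha beta lambda)
    (F_obj Psi Phi A b lambda).
Proof.
move=> _ _ _ _ _ _ _ AAK alpha0 beta0 T_posdef albe.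
pose s (XY : 'M[R]_(n, r) * 'M[R]_(n, r)) : 'M[R]_n :=
  XY.1 *m XY.2^T + alpha^-1 *: adjmap A (b - A (XY.1 *m XY.2^T)).
apply: (@equivalent_problems_partial_min _ _ _ _ _ s) => -[X Y] => [|Z] /=.
  (* D = 0 gives the value at [s]; below, D = Z - s (X, Y) gives the lower bound at any Z. *)
  have /= := penalty_complete_square b (X *m Y^T) 0 AAK alpha0 beta0 albe.
  by rewrite addr0 /frob_dot mulmx0 mxtrace0 mulr0 addr0 => ->.
have /= := penalty_complete_square b (X *m Y^T) (Z - s (X, Y))
  AAK alpha0 beta0 albe.
rewrite -/(s (X, Y)) subrKC => ->.
(* Psi X + Phi Y, possibly infinite, is common to both sides; what remains is that the quadratic
   form is nonnegative. *)
rewrite leeD2l// lee_fin lerD2r lerDl mulr_ge0 ?invr_ge0//.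
exact: (posdef_ge0 _ T_posdef).
Qed.
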